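(* Let $K$ be a field, let $I$ be a non-zero monomial ideal in the polynomial ring $S=K[x_1,\ldots,x_n]$, and let $d := \max\{\deg(u) : u \in \mathcal{G}(I)\}$. Let $i \geq 0$ and $j \geq i+d$ be integers such that $$\beta^K_{i,j}(I) = \beta^K_{i,j+1}(I) = \cdots = \beta^K_{i,j+(d-1)}(I) = 0.$$ Then $\beta^K_{i+1,j+d}(I) = 0$.
   Context: $S=K[x_1,\ldots,x_n]$ carries the standard grading $\deg(x_i)=1$. For a monomial ideal $I\subset S$, $\mathcal{G}(I)$ denotes the unique minimal set of monomial generators of $I$. For a finitely generated graded $S$-module $M$, the graded Betti numbers are $\beta^K_{i,j}(M)=\dim_K \mathrm{Tor}^S_i(K,M)_j$. Here $I$ itself (not $S/I$) is regarded as a graded $S$-module. *)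

(* Defs.v *)
From HB Require Import structures.
From mathcomp Require Import all_boot all_order all_algebra.
From mathcomp.multinomials Require Import mpoly.

Set Implicit Arguments.
Unset Strict Implicit.
Unset Printing Implicit Defensive.

Import GRing.Theory.
Local Open Scope ring_scope.

Section MonomialIdeals.
Variables (n : nat) (K : fieldType).
Local Notation S := {mpoly K[n]}.

(* I is the ideal of S generated by the monomials 'X_[m] with A m. *)
Definition generated_by (A : 'X_{1..n} -> Prop) (I : S -> Prop) : Prop :=
  forall f : S, I f <->
    exists s : seq (S * 'X_{1..n}),
      (forall p, p \in s -> A p.2) /\ f = \sum_(p <- s) p.1 * 'X_[p.2].

Definition monomial_ideal (I : S -> Prop) : Prop :=
  exists A : 'X_{1..n} -> Prop, generated_by A I.

(* "G = G(I)": monomials are represented by their exponents, and minimality is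
   with respect to inclusion among the sets of monomials generating I. *)
Definition minimal_generators (I : S -> Prop) (G : 'X_{1..n} -> Prop) : Prop :=
  generated_by G I /\
  forall G' : 'X_{1..n} -> Prop,
    (forall u, G' u -> G u) -> generated_by G' I -> forall u, G u -> G' u.

(* A resolution ... -> F_1 -> F_0 -> I -> 0 by graded free modules of finite
   rank, F_i = \bigoplus_k S(- shift i k).  Elements of F_i are row vectors, so
   the differential F_(i+1) -> F_i is v |-> v *m dif i and the augmentation
   F_0 -> I is v |-> v *m aug; both preserve degrees.  Minimality of the
   resolution is not required. *)
Record graded_free_resolution (I : S -> Prop) := GradedFreeResolution {
  rk : nat -> nat;
  shift : forall i, 'I_(rk i) -> int;
  dif : forall i, 'M[S]_(rk i.+1, rk i);
  aug : 'cV[S]_(rk 0);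
  dif_homog : forall i (k : 'I_(rk i.+1)) (l : 'I_(rk i)) (m : 'X_{1..n}),
    m \in msupp (dif i k l) -> shift k = (mdeg m)%:Z + shift l;
  aug_homog : forall (k : 'I_(rk 0)) (m : 'X_{1..n}),
    m \in msupp (aug k 0) -> shift k = (mdeg m)%:Z;
  dif_exact : forall i (v : 'rV[S]_(rk i.+1)),
    v *m dif i = 0 <-> exists w : 'rV[S]_(rk i.+2), v = w *m dif i.+1;
  aug_exact : forall v : 'rV[S]_(rk 0),
    v *m aug = 0 <-> exists w : 'rV[S]_(rk 1), v = w *m dif 0;
  aug_onto : forall f : S,
    I f <-> exists v : 'rV[S]_(rk 0), f = (v *m aug) 0 0
}.

Section Tor.
Variables (I : S -> Prop) (F : graded_free_resolution I).

(* The complex F (x)_S K, where K = S/(x_1, ..., x_n): every polynomial entry is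
   replaced by its constant term, and F_i (x) K = 'rV[K]_(rk F i). *)
Definition dif_tensor (i : nat) : 'M[K]_(rk F i.+1, rk F i) :=
  map_mx (mcoeff 0%MM) (dif F i).

(* The row space of this matrix is the component of degree j of F_i (x) K,
   spanned by the basis vectors of degree j. *)
Definition degree_part (i : nat) (j : int) : 'M[K]_(rk F i) :=
  diag_mx (\row_(k < rk F i) (shift k == j)%:R).

Definition tensor_cycles (i : nat) : 'M[K]_(rk F i) :=
  if i is i'.+1 then kermx (dif_tensor i') else 1%:M.

(* \beta_(i,j)(I) = dim_K Tor_i(K, I)_j = dim_K H_i(F (x)_S K)_j; Tor may be
   computed from any graded free resolution F of I. *)
Definition graded_betti (i : nat) (j : int) : nat :=
  (\rank (tensor_cycles i :&: degree_part i j)%MS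
   - \rank (degree_part i.+1 j *m dif_tensor i))%N.

End Tor.

End MonomialIdeals.

(* Main.v *)
(* Let alpha be a multidegree with |alpha| = j + d at which beta_(i+1) could be
   nonzero, and let x^u be a generator dividing x^alpha.  If a cycle z
   represents a class of Tor_(i+1)(K, I) in multidegree alpha, its boundary
   lives in multidegrees gamma < alpha.  Its components at the gamma with
   lcm(x^u, x^gamma) = x^alpha can be killed one degree at a time, since such
   gamma satisfy j <= |gamma| < j + d and beta_(i, |gamma|) = 0.  Afterwards the
   cone with apex u shows that z is a boundary.
   The multigraded argument is carried out on the variant of the Taylor
   resolution with basis the tuples of generators, repetitions allowed, for
   which coning needs no signs; a given Z-graded resolution has the same
   vanishing Betti numbers by the comparison theorem. *)
Require Import Defs.
From mathcomp Require Import all_boot all_order all_algebra.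
From mathcomp.multinomials Require Import mpoly.

Set Implicit Arguments.
Unset Strict Implicit.
Unset Printing Implicit Defensive.

Import GRing.Theory.
Local Open Scope ring_scope.

(** * Homogeneous components of polynomials and homogeneous matrices *)

Section Homogeneous.
Variables (n : nat) (K : fieldType).
Local Notation S := {mpoly K[n]}.

Definition hpart (s : int) (p : S) : S :=
  \sum_(m <- msupp p | (mdeg m)%:Z == s) p@_m *: 'X_[m].

Lemma mcoeff_hpart s (p : S) m :
  (hpart s p)@_m = if (mdeg m)%:Z == s then p@_m else 0.
Proof.
rewrite /hpart raddf_sum /= big_mkcond /=.
transitivity (\sum_(i <- msupp p)
    if i == m then (if (mdeg m)%:Z == s then p@_m else 0) else 0).
  apply: eq_bigr => i _; rewrite mcoeffZ mcoeffX.
  have [->|_] := eqVneq i m; first by rewrite mulr1.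
  by rewrite mulr0 if_same.
rewrite -big_mkcond /= -big_filter.
have [mp|mp] := boolP (m \in msupp p).
  by rewrite filter_pred1_uniq ?msupp_uniq // big_seq1.
rewrite big_seq big1; last first.
  by move=> i; rewrite mem_filter => /andP[/eqP-> im]; rewrite im in mp.
by rewrite (memN_msupp_eq0 mp) if_same.
Qed.

Lemma hpart_id s (p : S) :
  (forall m, m \in msupp p -> (mdeg m)%:Z = s) -> hpart s p = p.
Proof.
move=> hp; apply/mpolyP => m; rewrite mcoeff_hpart.
case: ifP => // /eqP ms; case: (boolP (m \in msupp p)) => [/hp//|].
by move/memN_msupp_eq0 ->.
Qed.

Lemma hpartM s e (p q : S) :
  (forall m, m \in msupp q -> (mdeg m)%:Z = e) ->
  hpart s p * q = hpart (s + e) (p * q).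
Proof.
move=> hq; apply/mpolyP => m; rewrite mcoeff_hpart !mcoeffM.
transitivity (\sum_(k : 'X_{1..n < (mdeg m).+1, (mdeg m).+1} | m == (k.1 +
  k.2)%MM)
   if (mdeg m)%:Z == s + e then p@_k.1 * q@_k.2 else 0); last first.
  by case: (_ == _) => //; rewrite big1.
apply: eq_bigr => k /eqP mk; rewrite mcoeff_hpart.
have [/hq ke|/memN_msupp_eq0 ->] := boolP (bmnm k.2 \in msupp q); last first.
  by rewrite !mulr0 if_same.
have -> : (mdeg m)%:Z = (mdeg k.1)%:Z + e by rewrite -ke -PoszD -mdegD -mk.
rewrite (inj_eq (addIr e)).
by case: ifP => // _; rewrite mul0r.
Qed.

Lemma hpart_sum s (T : Type) (r : seq T) (f : T -> S) :
  hpart s (\sum_(i <- r) f i) = \sum_(i <- r) hpart s (f i).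
Proof.
apply/mpolyP => m; rewrite mcoeff_hpart !(raddf_sum (mcoeff m)) /=.
rewrite [RHS](eq_bigr _ (fun i _ => mcoeff_hpart s (f i) m)).
by case: (_ == s) => //; rewrite big1.
Qed.

Definition homogeneous_mx p q (s : 'I_p -> int) (t : 'I_q -> int)
    (A : 'M[S]_(p, q)) :=
  forall k l m, m \in msupp (A k l) -> s k = (mdeg m)%:Z + t l.

Lemma homogeneous_mxM p q r (s : 'I_p -> int) (t : 'I_q -> int)
    (u : 'I_r -> int) (A : 'M[S]_(p, q)) (B : 'M[S]_(q, r)) :
  homogeneous_mx s t A -> homogeneous_mx t u B -> homogeneous_mx s u (A *m B).
Proof.
move=> hA hB k l m; rewrite mxE => /msupp_sum_le/flattenP[/= x].
case/mapP => i _ -> /msuppM_le/allpairsP[/= [a b] [/= /hA -> /hB -> ->]].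
by rewrite mdegD PoszD addrA.
Qed.

(* Replacing every entry by its component of the right degree turns any
   factorization through a homogeneous matrix into a homogeneous one. *)
Lemma homogeneous_factor p q r (s : 'I_p -> int) (t : 'I_q -> int)
    (u : 'I_r -> int) (A : 'M[S]_(p, r)) (D : 'M[S]_(q, r)) :
  homogeneous_mx s u A -> homogeneous_mx t u D ->
  (exists B, A = B *m D) -> exists B, homogeneous_mx s t B /\ A = B *m D.
Proof.
move=> hA hD [B AE]; exists (\matrix_(i, j) hpart (s i - t j) (B i j)); split.
  move=> k l m; rewrite mxE mcoeff_msupp mcoeff_hpart.
  by case: ifP => [/eqP ->|]; rewrite ?eqxx // subrK.
apply/matrixP => i j.
have <- : hpart (s i - u j) (A i j) = A i j.
  by apply: hpart_id => m /hA ->; rewrite addrK.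
rewrite {1}AE !mxE hpart_sum; apply: eq_bigr => k _; rewrite mxE.
rewrite (@hpartM _ (t k - u j)) ?subrKA // => m /hD ->.
by rewrite addrK.
Qed.

Lemma row_factor p q r (A : 'M[S]_(p, r)) (D : 'M[S]_(q, r)) :
  (forall i, exists w, row i A = w *m D) -> exists B, A = B *m D.
Proof.
move=> /fin_all_exists[w wE]; exists (\matrix_i w i).
by apply/row_matrixP => i; rewrite wE row_mul rowK.
Qed.

End Homogeneous.

(** * Degree strands of a resolution tensored with [K] *)

Section Strands.
Variables (n : nat) (K : fieldType) (I : {mpoly K[n]} -> Prop).
Local Notation S := {mpoly K[n]}.
Local Notation const_term := (mcoeff (0%MM : 'X_{1..n})).
Implicit Type F : graded_free_resolution I.

Lemma map_mx_mcoeff0M p q r (A : 'M[S]_(p, q)) (B : 'M[S]_(q, r)) :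
  map_mx const_term (A *m B) = map_mx const_term A *m map_mx const_term B.
Proof. exact: map_mxM. Qed.

(** Counting the augmentation as the map leaving degree 0 gives one exactness statement for all
    degrees. *)
Definition out F a :
    'M[S]_(rk F a, match a with 0 => 1 | a'.+1 => rk F a' end) :=
  match a with 0 => aug F | a'.+1 => dif F a' end.

Lemma out_exact F a (v : 'rV[S]_(rk F a)) :
  v *m out F a = 0 <-> exists w, v = w *m dif F a.
Proof. case: a v => [|a] v; [exact: aug_exact | exact: dif_exact]. Qed.

Lemma dif_out F a : dif F a *m out F a = 0.
Proof.
apply/row_matrixP => i; rewrite row_mul row0; apply/out_exact.
by exists (delta_mx 0 i); rewrite -rowE.
Qed.

Lemma out_factor F a p (A : 'M[S]_(p, rk F a)) :
  A *m out F a = 0 -> exists B, A = B *m dif F a.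
Proof.
move=> A0; apply: row_factor => i; apply/out_exact.
by rewrite -row_mul A0 row0.
Qed.

Lemma mul_degree_part F a p (j : int) (A : 'M[K]_(p, rk F a)) i k :
  (A *m degree_part F a j) i k = if shift k == j then A i k else 0.
Proof.
by rewrite mul_mx_diag !mxE; case: eqP; rewrite ?mulr1 ?mulr0.
Qed.

Lemma mul_degree_part_homog F F' a b j p (A : 'M[S]_(rk F a, rk F' b))
    (v : 'M[K]_(p, rk F a)) :
  homogeneous_mx (@shift _ _ _ F a) (@shift _ _ _ F' b) A ->
  v *m degree_part F a j *m map_mx const_term A =
  v *m map_mx const_term A *m degree_part F' b j.
Proof.
move=> hA; apply/matrixP => i k; rewrite mul_degree_part !mxE.
transitivity (\sum_l if shift k == j then
   v i l * map_mx const_term A l k else 0); last first.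
  by case: (_ == _) => //; rewrite big1.
apply: eq_bigr => l _; rewrite mul_degree_part mxE.
have [/hA|/memN_msupp_eq0 ->] := boolP (0%MM \in msupp (A l k)); last first.
  by rewrite !mulr0 if_same.
by rewrite mdeg0 add0r => ->; case: ifP => // _; rewrite mul0r.
Qed.

(** The subtraction truncates, but boundaries of degree [j] always lie among the cycles of degree
    [j], so it gives zero exactly when the two spaces agree. Projecting a preimage to degree [j]
    shows that a boundary of degree [j] comes from a chain of degree [j]. *)
Lemma betti_eq0P F i j : graded_betti F i j = 0%N <->
  forall v : 'rV[K]_(rk F i), (v <= tensor_cycles F i)%MS ->
    v *m degree_part F i j = v -> (v <= dif_tensor F i)%MS.
Proof.
have hdif : homogeneous_mx (@shift _ _ _ F i.+1) (@shift _ _ _ F i) (dif F i).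
  by move=> k l m; apply: dif_homog.
have degK a : degree_part F a j *m degree_part F a j = degree_part F a j.
  apply/matrixP => k l; rewrite mul_degree_part; case: ifP => //.
  by rewrite !mxE; case: (k =P l) => [->|_] => [->|]; rewrite ?mulr0n //.
have le_dif p (v : 'M_(p, _)) :
    v *m degree_part F i j = v -> (v <= dif_tensor F i)%MS ->
    (v <= degree_part F i.+1 j *m dif_tensor F i)%MS.
  move=> vj /submxP[w vE];
    rewrite -vj vE /dif_tensor -mul_degree_part_homog // -mulmxA.
  exact: submxMl.
have le_cyc : (degree_part F i.+1 j *m dif_tensor F i <=
               tensor_cycles F i :&: degree_part F i j)%MS.
  rewrite sub_capmx; apply/andP; split; last first.
    rewrite -[X in (X *m _)%MS]mul1mx mul_degree_part_homog //.
    exact: submxMl.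
  apply: (submx_trans (submxMl _ _)).
  case: (i) => [|i'] /=; first exact: submx1.
  apply/sub_kermxP; rewrite -map_mx_mcoeff0M.
  by have /= -> := dif_out F i'.+1; rewrite raddf0.
rewrite /graded_betti; split=> [/eqP|h].
  rewrite subn_eq0 => le_rk v vc vj.
  have le : (tensor_cycles F i :&: degree_part F i j <=
             degree_part F i.+1 j *m dif_tensor F i)%MS.
    by rewrite -(geq_leqif (mxrank_leqif_sup le_cyc)).
  apply: (submx_trans _ (submx_trans le (submxMl _ _))).
  by rewrite sub_capmx vc -{1}vj submxMl.
apply/eqP; rewrite subn_eq0; apply: mxrankS.
apply: le_dif.
  have /submxP[w ->] : (tensor_cycles F i :&: degree_part F i j <=
      degree_part F i j)%MS by exact: capmxSr.
  by rewrite -mulmxA degK.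
apply/row_subP => k; apply: h.
  exact: submx_trans (row_sub _ _) (capmxSl _ _).
have /submxP[w ->] : (row k (tensor_cycles F i :&: degree_part F i j) <=
      degree_part F i j)%MS by exact: submx_trans (row_sub _ _) (capmxSr _ _).
by rewrite -mulmxA degK.
Qed.

End Strands.

(** * Comparison of graded free resolutions *)

Section Comparison.
Variables (n : nat) (K : fieldType) (I : {mpoly K[n]} -> Prop).
Local Notation S := {mpoly K[n]}.
Local Notation const_term := (mcoeff (0%MM : 'X_{1..n})).
Implicit Type F : graded_free_resolution I.

Lemma aug_factor F F' : exists A : 'M[S]_(rk F 0, rk F' 0),
  homogeneous_mx (@shift _ _ _ F 0) (@shift _ _ _ F' 0) A /\
  aug F = A *m aug F'.
Proof.
apply: (@homogeneous_factor _ _ _ _ _ _ _ (fun=> 0)).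
- by move=> k l m; rewrite ord1 addr0; apply: aug_homog.
- by move=> k l m; rewrite ord1 addr0; apply: aug_homog.
apply: row_factor => i.
have /(aug_onto F')[v vE] : I (aug F i 0).
  by apply/(aug_onto F); exists (delta_mx 0 i); rewrite -rowE mxE.
by exists v; apply/matrixP => k l; rewrite !ord1 -vE mxE.
Qed.

(* [phi] and [psi] are the components in degree [a] of lifts F -> F' and
   F' -> F of the identity of [I]; [s] is a homotopy, and [r] is the part of it
   that factors through the differential leaving degree [a]. *)
Lemma comparison F F' a :
  exists (phi : 'M[S]_(rk F a, rk F' a)) (psi : 'M[S]_(rk F' a, rk F a))
         (s : 'M[S]_(rk F a, rk F a.+1)) (r : 'M[S]_(rk F a)),
  [/\ homogeneous_mx (@shift _ _ _ F a) (@shift _ _ _ F' a) phi /\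
      (forall v : 'rV[K]_(rk F a), (v <= tensor_cycles F a)%MS ->
         (v *m map_mx const_term phi <= tensor_cycles F' a)%MS),
      exists b, dif F a *m phi = b *m dif F' a,
      exists b, dif F' a *m psi = b *m dif F a,
      1%:M - phi *m psi = r + s *m dif F a &
      dif F a *m r = 0 /\
      forall v : 'rV[K]_(rk F a), (v <= tensor_cycles F a)%MS ->
        v *m map_mx const_term r = 0].
Proof.
elim: a => [|a [phi [psi [s [r]]]]].
  have [phi [hphi phiE]] := aug_factor F F'.
  have [psi [_ psiE]] := aug_factor F' F.
  have [s sE] : exists s, 1%:M - phi *m psi = s *m dif F 0.
    by apply: out_factor; rewrite /= mulmxBl mul1mx -mulmxA -psiE -phiE subrr.
  exists phi, psi, s, 0; split.
  - by split=> // v _; apply: submx1.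
  - by apply: out_factor; rewrite /= -mulmxA -phiE; apply: (dif_out F 0).
  - by apply: out_factor; rewrite /= -mulmxA -psiE; apply: (dif_out F' 0).
  - by rewrite add0r.
  - by split=> [|v _]; rewrite ?mulmx0 // raddf0 mulmx0.
case=> [[hphi _] phi_dif [psi1 psi1E] sE [r0 _]].
have [phi1 [hphi1 phi1E]] : exists phi1 : 'M[S]_(rk F a.+1, rk F' a.+1),
    homogeneous_mx (@shift _ _ _ F a.+1) (@shift _ _ _ F' a.+1) phi1 /\
    dif F a *m phi = phi1 *m dif F' a.
  apply: homogeneous_factor phi_dif; last by move=> k l m; apply: dif_homog.
  by apply: homogeneous_mxM hphi => k l m; apply: dif_homog.
(* Composing the left-hand side with [dif F a] leaves [dif F a *m r], which is zero by induction;
   exactness then yields [s1]. *)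
have [s1 s1E] : exists s1, 1%:M - phi1 *m psi1 - dif F a *m s =
    s1 *m dif F a.+1.
  apply: out_factor; rewrite /= !mulmxBl mul1mx -!mulmxA -psi1E.
  rewrite (mulmxA phi1) -phi1E -{1}[dif F a]mulmx1 -mulmxA -mulmxBr -mulmxBr sE.
  by rewrite addrK.
exists phi1, psi1, s1, (dif F a *m s); split.
- split=> // v /sub_kermxP v0; apply/sub_kermxP.
  by rewrite -mulmxA -map_mx_mcoeff0M -phi1E map_mx_mcoeff0M mulmxA v0 mul0mx.
- apply: out_factor; rewrite /= -mulmxA -phi1E mulmxA.
  by have /= -> := dif_out F a.+1; rewrite mul0mx.
- apply: out_factor; rewrite /= -mulmxA -psi1E mulmxA.
  by have /= -> := dif_out F' a.+1; rewrite mul0mx.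
- by rewrite -s1E [RHS]addrC subrK.
- split=> [|v /sub_kermxP v0].
    by rewrite mulmxA; have /= -> := dif_out F a.+1; rewrite mul0mx.
  by rewrite map_mx_mcoeff0M mulmxA v0 mul0mx.
Qed.

(** A cycle is sent by [phi] to [F'], where it bounds, and brought back by [psi]. The term [r]
    vanishes on cycles, so the round trip changes the cycle only by a boundary. *)
Lemma betti_eq0_independent F F' i j :
  graded_betti F' i j = 0%N -> graded_betti F i j = 0%N.
Proof.
move=> /betti_eq0P h; apply/betti_eq0P => v vc vj.
have [phi [psi [s [r]]]] := comparison F F' i.
case=> [[hphi phi_cyc] _ [psi1 psi1E] sE [_ r0]].
have phi_vj : v *m map_mx const_term phi *m degree_part F' i j =
    v *m map_mx const_term phi by rewrite -mul_degree_part_homog // vj.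
have /submxP[w wE] := h _ (phi_cyc _ vc) phi_vj.
have : v - v *m map_mx const_term phi *m map_mx const_term psi =
       v *m map_mx const_term s *m dif_tensor F i.
  have /(congr1 (mulmx v \o map_mx const_term)) /= := sE.
  rewrite map_mxB map_mxD map_mx1.
  rewrite !map_mx_mcoeff0M.
  by rewrite mulmxBr mulmxDr r0 // add0r mulmx1 !mulmxA.
rewrite wE.
move/(canRL (subrK _)) ->; apply: addmx_sub; first exact: submxMl.
by rewrite -mulmxA -map_mx_mcoeff0M psi1E map_mx_mcoeff0M mulmxA submxMl.
Qed.

End Comparison.

(** * Ordered simplicial chains and the cone homotopy *)

Section OrderedChains.
Variables (K : fieldType) (T : finType).
Implicit Types (f g : seq T -> K) (s t : seq T) (p : nat).

Definition cone (u : T) f : seq T -> K :=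
  fun s => if s is b :: t then (b == u)%:R * f t else 0.

(* [bd s t] is the coefficient of [t] in the boundary of the ordered simplex
   [s], repetitions of vertices being allowed; the recursion makes [cone] a
   contracting homotopy by construction. *)
Fixpoint bd s : seq T -> K :=
  if s is b :: s' then fun t => (s' == t)%:R - cone b (bd s') t else fun=> 0.

Definition bound p f t : K := \sum_(s : p.-tuple T) f s * bd s t.

Lemma big_tuple_cons (V : nmodType) p (F : seq T -> V) :
  \sum_(s : p.+1.-tuple T) F s = \sum_b \sum_(s : p.-tuple T) F (b :: s).
Proof.
rewrite pair_big /= (reindex (fun x : T * p.-tuple T => cons_tuple x.1 x.2))
  //=.
exists (fun x : p.+1.-tuple T => (thead x, behead_tuple x)) => [[b x] _|x _] /=.
  by congr pair; apply: val_inj.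
by rewrite [RHS]tuple_eta.
Qed.

Lemma sum_tuple_eq p f t :
  \sum_(s : p.-tuple T) f s * (val s == t)%:R =
  if size t == p then f t else 0.
Proof.
case: eqP => [tp|tp].
  rewrite (bigD1 (tcast tp (in_tuple t))) //= val_tcast eqxx mulr1.
  rewrite big1 ?addr0 // => s; rewrite -val_eqE /= val_tcast /=.
  by case: eqP => //; rewrite mulr0.
rewrite big1 // => s _; case: eqP => [st|_]; last by rewrite mulr0.
by case: tp; rewrite -st size_tuple.
Qed.

(** The homotopy identity: a cone bounds its base minus the cone over the boundary of the base. The
    size test appears because [bound] sums over tuples of a single length. *)
Lemma bound_cone p u f t :
  bound p.+1 (cone u f) t =
  (if size t == p then f t else 0) - cone u (bound p f) t.
Proof.
rewrite /bound (big_tuple_cons p (fun s => cone u f s * bd s t)) (bigD1 u) //=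
  [X in _ + X]big1 ?addr0; last first.
  by move=> b /negPf bu; rewrite big1 // => s _; rewrite bu !mul0r.
under eq_bigr do rewrite eqxx mul1r mulrBr.
rewrite big_split /= sum_tuple_eq; congr (_ + _).
rewrite sumrN; congr (- _); case: t => [|c t] /=.
  by rewrite big1 // => s _; rewrite mulr0.
by rewrite mulr_sumr; apply: eq_bigr => s _; rewrite eq_sym mulrCA.
Qed.

Lemma bd_size s t : bd s t != 0 -> size s = (size t).+1.
Proof.
elim: s t => [|b s IHs] t /=; first by rewrite eqxx.
have [->|_] := eqVneq s t => //; rewrite sub0r oppr_eq0.
case: t => [|c t] /=; first by rewrite eqxx.
by rewrite mulf_eq0 negb_or => /andP[_ /IHs ->].
Qed.

(** The boundary of [b :: s] is [s] minus the cone over [bd s]. By [bound_cone] the two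
    contributions [bd s] cancel, and the remaining cone is over a double boundary, zero by
    induction. *)
Lemma bound_bd p s t : size s = p.+1 -> bound p (bd s) t = 0.
Proof.
elim: s p t => // b s IHs p t [sp].
rewrite /bound /=.
under eq_bigr do rewrite mulrBl.
rewrite big_split /= sumrN.
have -> : \sum_(x : p.-tuple T) (s == x)%:R * bd x t = bd s t.
  under eq_bigr do rewrite mulrC eq_sym.
  by rewrite (sum_tuple_eq p (fun x => bd x t)) sp eqxx.
rewrite -[X in _ - X]/(bound p (cone b (bd s)) t).
case: p sp => [|p] sp.
  rewrite (size0nil sp) /bound big1 ?subr0 // => x _.
  by rewrite (tuple0 x) /= mul0r.
rewrite bound_cone; have -> : cone b (bound p (bd s)) t = 0.
  by case: t => //= c t; rewrite IHs ?mulr0.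
rewrite subr0; case: eqP => [_|tp]; first by rewrite subrr.
rewrite subr0; apply/eqP; apply: contraTT isT => /bd_size.
by rewrite sp => -[/esym].
Qed.

Lemma bound_bound p f t : bound p (bound p.+1 f) t = 0.
Proof.
rewrite /bound; under eq_bigr do rewrite mulr_suml.
rewrite exchange_big big1 //= => s _.
under eq_bigr do rewrite -mulrA.
by rewrite -mulr_sumr [X in _ * X]bound_bd ?mulr0 // size_tuple.
Qed.

End OrderedChains.

(** * Multidegrees of simplices and the boundary tensored with [K] *)

Section Lcm.
Variables (n : nat) (K : fieldType) (T : finType) (a : T -> 'X_{1..n}).
Implicit Types (s t : seq T) (f g z w : seq T -> K) (m : 'X_{1..n}).

Lemma lepm_anti m1 m2 : (m1 <= m2)%MM -> (m2 <= m1)%MM -> m1 = m2.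
Proof.
move=> /mnm_lepP le12 /mnm_lepP le21; apply/mnmP => i.
by apply/eqP; rewrite eqn_leq le12 le21.
Qed.

Lemma lepm_mdeg m1 m2 : (m1 <= m2)%MM -> (mdeg m1 <= mdeg m2)%N.
Proof. by move=> /submK <-; rewrite mdegD leq_addl. Qed.

Lemma lepm_mdeg_eq m1 m2 : (m1 <= m2)%MM -> (mdeg m2 <= mdeg m1)%N -> m1 = m2.
Proof.
move=> /submK <-; rewrite mdegD -{2}[mdeg m1]add0n leq_add2r leqn0 mdeg_eq0.
by move=> /eqP ->; rewrite add0m.
Qed.

Lemma mdeg_mlcm m1 m2 : (mdeg (mlcm m1 m2) <= mdeg m1 + mdeg m2)%N.
Proof. by rewrite mlcmE mdegD leq_add2l lepm_mdeg ?lem_subr. Qed.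

Lemma mlcm_leS m m1 m2 : (m1 <= m2)%MM -> (mlcm m m1 <= mlcm m m2)%MM.
Proof.
move=> le12; rewrite lem_mlcm lem_mlcml /=.
exact: lepm_trans le12 (lem_mlcmr _ _).
Qed.

Fixpoint lcms s : 'X_{1..n} := if s is b :: s' then mlcm (a b) (lcms s') else
  0%MM.

Lemma bd_lcms s t : bd K s t != 0 -> (lcms t <= lcms s)%MM.
Proof.
elim: s t => [|b s IHs] t /=; first by rewrite eqxx.
have [<- _|_] := eqVneq s t; first exact: lem_mlcmr.
rewrite sub0r oppr_eq0; case: t => [|c t] /=; first by rewrite eqxx.
have [-> |] := eqVneq c b; last by rewrite mul0r eqxx.
by rewrite mul1r => /IHs; apply: mlcm_leS.
Qed.

(* The boundary tensored with K: an entry 'X_[lcms s - lcms t] of the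
   differential survives exactly when the two lcms agree. *)
Definition bd_tensor s t : K := if lcms s == lcms t then bd K s t else 0.

Definition bound_tensor p f t : K :=
  \sum_(s : p.-tuple T) f s * bd_tensor s t.

(** The two boundaries differ only where passing to a face strictly lowers the lcm; the hypothesis
    excludes this at [t]. *)
Lemma bound_eq_tensor p f t :
  (forall s : p.-tuple T, f s != 0 -> (lcms t <= lcms s)%MM ->
     lcms s = lcms t) ->
  bound p f t = bound_tensor p f t.
Proof.
move=> h; apply: eq_bigr => s _; rewrite /bd_tensor; case: eqP => // ne.
have [->|f0] := eqVneq (f s) 0; first by rewrite !mul0r.
have [->//|/bd_lcms le] := eqVneq (bd K s t) 0.
by case: ne; apply: h.
Qed.

Lemma eq_bound_tensor p f g t :
  (forall s : p.-tuple T, lcms s = lcms t -> f s = g s) ->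
  bound_tensor p f t = bound_tensor p g t.
Proof.
move=> h; apply: eq_bigr => s _; rewrite /bd_tensor; case: eqP => [/h->//|_].
by rewrite !mulr0.
Qed.

(** * Vanishing across a gap of [d] degrees *)

Section Gap.
Variables (d i j : nat).
Hypothesis a_le_d : forall b, (mdeg (a b) <= d)%N.
(** Vanishing of Tor in homological degree [i], which lives on tuples of length [i.+1]. The guard
    [0 < i] makes every chain a cycle in degree 0, where the complex stops short of the empty
    tuple. *)
Hypothesis exact_i : forall k, (k < d)%N -> forall f,
  (forall t, size t = i -> (0 < i)%N -> bound_tensor i.+1 f t = 0) ->
  (forall t, size t = i.+1 -> f t != 0 -> mdeg (lcms t) = (j + k)%N) ->
  exists w, forall t, size t = i.+1 -> f t = bound_tensor i.+2 w t.

Section MultiDegree.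
Variables (f : seq T -> K) (alpha : 'X_{1..n}) (u : T).
Hypothesis f_cycle : forall t, size t = i.+1 -> bound_tensor i.+2 f t = 0.
Hypothesis mdeg_alpha : mdeg alpha = (j + d)%N.
Hypothesis u_le : (a u <= alpha)%MM.

(** These are the [t] whose cone [u :: t] has multidegree [alpha]: only there does a boundary
    obstruct the coning argument. *)
Let near t := mlcm (a u) (lcms t) == alpha.

Lemma near_le t : near t -> (lcms t <= alpha)%MM.
Proof. by move/eqP <-; apply: lem_mlcmr. Qed.

Lemma near_up s t :
  near t -> (lcms t <= lcms s)%MM -> (lcms s <= alpha)%MM -> near s.
Proof.
move=> /eqP nt ts sa; apply/eqP; apply: lepm_anti.
  by rewrite lem_mlcm u_le.
by rewrite -nt mlcm_leS.
Qed.

(* Subtracting chains of multidegree < alpha from the part of [f] in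
   multidegree [alpha], remove the multidegrees gamma with
   lcm(u, gamma) = alpha from its boundary, in decreasing order of degree. *)
Lemma clear_near k : (k <= d)%N -> exists z,
  [/\ forall s, size s = i.+2 -> z s != 0 -> (lcms s <= alpha)%MM,
      forall s, size s = i.+2 -> lcms s = alpha -> z s = f s &
      forall t, size t = i.+1 -> near t -> (j + d <= mdeg (lcms t) + k)%N ->
        bound i.+2 z t = 0].
Proof.
elim: k => [|k IHk] kd.
  exists (fun s => if lcms s == alpha then f s else 0); split.
  - by move=> s _; case: ifP => [/eqP -> _|_]; rewrite ?lepm_refl ?eqxx.
  - by move=> s _ ->; rewrite eqxx.
  move=> t st /near_le le_t; rewrite addn0 -mdeg_alpha => deg_t.
  have tE := lepm_mdeg_eq le_t deg_t.
  rewrite bound_eq_tensor => [|s]; last by case: ifP => [/eqP ->|_];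
    rewrite ?eqxx ?tE.
  rewrite -(f_cycle st); apply: eq_bound_tensor => s ->.
  by rewrite tE eqxx.
have [z [z_le zE z_clear]] := IHk (ltnW kd).
have jdE : (j + d = j + (d - k.+1) + k.+1)%N by rewrite -addnA subnK.
set m := (j + (d - k.+1))%N in jdE.
have high t : size t = i.+1 -> near t -> (m < mdeg (lcms t))%N ->
    bound i.+2 z t = 0.
  by move=> st nt mt; apply: z_clear => //; rewrite jdE addnS -addSn leq_add2r.
(* The next layer of the boundary to clear. It is a tensored cycle because the double boundary of
   [z] vanishes and any strictly larger multidegree that could contribute is near by [near_up],
   hence already cleared by [high]. *)
pose y t := if near t && (mdeg (lcms t) == m) then bound i.+2 z t else 0.
have y_cycle t : size t = i -> (0 < i)%N -> bound_tensor i.+1 y t = 0.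
  move=> st _; have [/andP[nt mt]|nt] := boolP (near t && (mdeg (lcms t) == m)).
    rewrite -(bound_bound i.+1 z t) bound_eq_tensor.
      apply: eq_bound_tensor => s st'; rewrite /y /near st' -/(near t) nt /=.
      by rewrite mt.
    move=> s z0 le; apply/eqP; apply: contraNT z0 => ne.
    have [s0 /andP[z0 b0]|z0] := pickP (fun s0 : i.+2.-tuple T =>
       (z s0 != 0) && (bd K s0 s != 0)); last first.
      rewrite /bound big1 // => s0 _; apply/eqP; move: (z0 s0).
      by rewrite mulf_eq0 -negb_or => /negbFE.
    apply/eqP/high; first by rewrite size_tuple.
      apply: near_up nt le _; apply: lepm_trans (bd_lcms b0) _.
      by rewrite z_le ?size_tuple.
    rewrite -(eqP mt) ltnNge; apply: contra ne => deg.
    by rewrite eq_sym (lepm_mdeg_eq le deg).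
  rewrite /bound_tensor big1 // => s _; rewrite /bd_tensor.
  case: eqP => [st'|_]; last by rewrite mulr0.
  by rewrite /y /near st' -/(near t) (negPf nt) mul0r.
have y_deg t : size t = i.+1 -> y t != 0 -> mdeg (lcms t) = m.
  by move=> _; rewrite /y; case: andP => [[_ /eqP]//|]; rewrite eqxx.
have kd' : (d - k.+1 < d)%N by rewrite ltn_subrL (leq_ltn_trans _ kd).
have [w wE] := exact_i kd' y_cycle y_deg.
(* Truncation keeps the tensored boundary at near faces of degree [m]. It leaves untouched both the
   part of [z] in multidegree [alpha], whose degree [j + d] exceeds [m], and the boundary in degrees
   above [m]. *)
pose w' s := if near s && (mdeg (lcms s) == m) then w s else 0.
exists (fun s => z s - w' s); split.
- move=> s ss; have [-> |z0 _] := eqVneq (z s) 0; last exact: z_le.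
  by rewrite sub0r oppr_eq0 /w'; case: andP => [[/near_le]//|]; rewrite eqxx.
- move=> s ss sE; rewrite zE // /w' sE mdeg_alpha jdE.
  by rewrite -{2}[m]addn0 eqn_add2l andbF subr0.
move=> t st nt deg_t.
have -> : bound i.+2 (fun s => z s - w' s) t = bound i.+2 z t - bound i.+2 w' t.
  by rewrite /bound -sumrB; apply: eq_bigr => s _; rewrite mulrBl.
have {deg_t} : (m <= mdeg (lcms t))%N by rewrite -(leq_add2r k.+1) -jdE.
have w'_deg (s : i.+2.-tuple T) : w' s != 0 -> mdeg (lcms s) = m.
  by rewrite /w'; case: andP => [[_ /eqP]//|]; rewrite eqxx.
rewrite leq_eqVlt => /orP[/eqP mt|mt]; last first.
  rewrite high // sub0r bound_eq_tensor => [|s /w'_deg ms /lepm_mdeg].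
    rewrite /bound_tensor big1 ?oppr0 // => s _; rewrite /bd_tensor.
    case: eqP => [st'|_]; last by rewrite mulr0.
    by rewrite /w' st' gtn_eqF // andbF mul0r.
  by rewrite ms leqNgt mt.
rewrite [bound _ w' t]bound_eq_tensor => [|s /w'_deg ms le]; last first.
  by symmetry; apply: lepm_mdeg_eq; rewrite ?ms ?mt.
have -> : bound_tensor i.+2 w' t = bound_tensor i.+2 w t.
  by apply: eq_bound_tensor => s st';
    rewrite /w' /near st' -/(near t) nt mt eqxx.
by rewrite -wE // /y nt mt eqxx subrr.
Qed.

(** By [bound_cone], [cone u z] bounds [z] up to a cone supported on simplices [u :: t]. When one of
    these has multidegree [alpha], its face [t] is near and the boundary of [z] there has been
    cleared. *)
Lemma gap_multidegree : exists w, forall t,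
  size t = i.+2 -> lcms t = alpha -> f t = bound_tensor i.+3 w t.
Proof.
have [z [z_le zE z_clear]] := clear_near (leqnn d).
exists (cone u z) => t st tE; rewrite -zE // -bound_eq_tensor.
  rewrite bound_cone st eqxx.
  case: t st tE => //= b t [st] tE; have [bu|] := eqVneq b u; last first.
    by rewrite mul0r subr0.
  rewrite z_clear ?mulr0 ?subr0 // /near -?bu ?tE ?eqxx // leq_add2r.
  (* Since [u] has degree at most [d] and [alpha] has degree [j + d], [lcms t] has degree at least
     [j]: the range cleared at [k = d]. *)
  rewrite -(leq_add2r d) -mdeg_alpha -tE addnC.
  apply: leq_trans (mdeg_mlcm _ _) _.
  by rewrite leq_add2r.
case; case=> //= b s ss.
have [-> |] := eqVneq b u; last by rewrite mul0r eqxx.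
rewrite mul1r tE => z0 le; apply: lepm_anti => //.
rewrite lem_mlcm u_le z_le //.
by case/eqP: ss.
Qed.

End MultiDegree.

Lemma gap f :
  (forall t, size t = i.+1 -> bound_tensor i.+2 f t = 0) ->
  (forall t, size t = i.+2 -> f t != 0 -> mdeg (lcms t) = (j + d)%N) ->
  exists w, forall t, size t = i.+2 -> f t = bound_tensor i.+3 w t.
Proof.
move=> f_cycle f_deg.
have /fin_all_exists[W WE] : forall x : i.+2.-tuple T, exists w,
    forall t, size t = i.+2 -> lcms t = lcms x -> f t = bound_tensor i.+3 w t.
  move=> x; have [deg_x|deg_x] := eqVneq (mdeg (lcms x)) (j + d)%N.
    apply: (gap_multidegree (u := thead x)) => //.
    by rewrite [tval x](congr1 val (tuple_eta x)) /= lem_mlcml.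
  exists (fun=> 0) => t st tx; rewrite /bound_tensor big1 => [|s _]; last first.
    by rewrite mul0r.
  by apply/eqP; apply: contraNT deg_x => /(f_deg t st) <-; rewrite tx.
(* The tensored boundary preserves multidegree, so solutions found separately can be glued. The
   chosen [x] depends only on [lcms s], hence is the same throughout one multidegree. *)
exists (fun s => if [pick x : i.+2.-tuple T | lcms x == lcms s] is Some x
                 then W x s else 0) => t st.
case E: [pick x : i.+2.-tuple T | lcms x == lcms t] => [x|]; last first.
  case: pickP E => // no _; have := no (tcast st (in_tuple t)).
  by rewrite val_tcast eqxx.
have tx : lcms t = lcms x by case: pickP E => // _ /eqP <- [->].
rewrite (WE x t) //; apply: eq_bound_tensor => s st'.
by rewrite st' E.
Qed.

End Gap.
End Lcm.

(** * Taylor differentials and their exactness *)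

Section TaylorMatrices.
Variables (n : nat) (K : fieldType) (T : finType) (a : T -> 'X_{1..n}).
Local Notation S := {mpoly K[n]}.
Local Notation lcms := (lcms a).
Implicit Types (s t : seq T) (m : 'X_{1..n}) (p : nat).

Lemma mcoeffMZX (f : S) c m e :
  (f * (c *: 'X_[m]))@_e = if (m <= e)%MM then f@_(e - m) * c else 0.
Proof.
rewrite -scalerAr mcoeffZ; case: ifP => [me|/negbT me].
  by rewrite -{1}(submK me) addmC mcoeffMX mulrC.
rewrite [X in _ * X](_ : _ = 0) ?mulr0 //.
apply/memN_msupp_eq0; apply: contra me;
  rewrite (perm_mem (msuppMX _ _)) => /mapP[x _ ->].
exact: lem_addr.
Qed.

Lemma mcoeff_trunc (E : 'X_{1..n} -> K) N m :
  (\sum_(x : 'X_{1..n < N}) E x *: 'X_[x] : S)@_m =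
  if (mdeg m < N)%N then E m else 0.
Proof.
case: ltnP => [|Nm]; first exact: mcoeff_mpoly.
rewrite (raddf_sum (mcoeff m)) big1 //= => x _; rewrite mcoeffZ mcoeffX.
case: eqP => [xm|_]; last by rewrite mulr0.
by have := bmdeg x; rewrite xm ltnNge Nm.
Qed.

Definition tdim p := #|{: p.-tuple T}|.

Definition simplex p (k : 'I_(tdim p)) : seq T :=
  enum_val (k : 'I_#|{: p.-tuple T}|).

Lemma size_simplex p (k : 'I_(tdim p)) : size (simplex k) = p.
Proof. exact: size_tuple. Qed.

Lemma simplex_onto p s : size s = p -> exists k : 'I_(tdim p), simplex k = s.
Proof.
move=> sp; exists (enum_rank (tcast sp (in_tuple s))).
by rewrite /simplex enum_rankK val_tcast.
Qed.

Lemma simplex_inj p : injective (@simplex p).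
Proof. by move=> k l /val_inj/enum_val_inj. Qed.

Lemma sum_simplex (V : nmodType) p (F : seq T -> V) :
  \sum_(k < tdim p) F (simplex k) = \sum_(x : p.-tuple T) F x.
Proof.
by rewrite [RHS](reindex (@enum_val _ {: p.-tuple T})) //=;
  apply/onW_bij/enum_val_bij.
Qed.

Definition extend (V : nmodType) p (v : 'rV[V]_(tdim p)) s : V :=
  if [pick k | simplex k == s] is Some k then v 0 k else 0.

Lemma extend_simplex (V : nmodType) p (v : 'rV[V]_(tdim p)) k :
  extend v (simplex k) = v 0 k.
Proof.
rewrite /extend; case: pickP => [l /eqP/simplex_inj->//|/(_ k)].
by rewrite eqxx.
Qed.

Definition taylor_mx p : 'M[S]_(tdim p.+1, tdim p) :=
  \matrix_(k, l) (bd K (simplex k) (simplex l) *: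
                  'X_[lcms (simplex k) - lcms (simplex l)]).

(** The multidegree [m] component of [v], seen as a chain; on it the Taylor differential becomes the
    plain [bound], as [slice_taylor] shows. *)
Definition slice p (v : 'rV[S]_(tdim p)) m s : K :=
  if (lcms s <= m)%MM then (extend v s)@_(m - lcms s) else 0.

Lemma slice_inj p (v w : 'rV[S]_(tdim p)) :
  (forall m s, size s = p -> (lcms s <= m)%MM -> slice v m s = slice w m s) ->
  v = w.
Proof.
move=> vw; apply/rowP => k; apply/mpolyP => e.
have := vw (e + lcms (simplex k))%MM _ (size_simplex k) (lem_addl _ _).
by rewrite /slice lem_addl addmK !extend_simplex.
Qed.

Lemma slice_taylor p (v : 'rV[S]_(tdim p.+1)) m t :
  size t = p -> (lcms t <= m)%MM ->
  slice (v *m taylor_mx p) m t = bound p.+1 (slice v m) t.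
Proof.
move=> /simplex_onto[l <-] le;
  rewrite /slice le extend_simplex mxE (raddf_sum (mcoeff _)) /=.
rewrite /bound -(sum_simplex p.+1 (fun s => slice v m s * bd K s (simplex l))).
apply: eq_bigr => k _; rewrite !mxE mcoeffMZX /slice extend_simplex.
have [->|/(bd_lcms a) kl] := eqVneq (bd K (simplex k) (simplex l)) 0.
  by rewrite !mulr0 if_same.
have -> : (lcms (simplex k) - lcms (simplex l) <= m - lcms (simplex l))%MM =
          (lcms (simplex k) <= m)%MM.
  apply/mnm_lepP/mnm_lepP => h x; have := h x; rewrite ?mnmBE.
    by rewrite leq_sub2rE // (mnm_lepP le).
  exact: leq_sub2r.
case: ifP => _; last by rewrite mul0r.
by rewrite submBA // submK.
Qed.

Lemma taylor_mxM p : taylor_mx p.+1 *m taylor_mx p = 0.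
Proof.
apply/matrixP => k l; rewrite !mxE.
transitivity (\sum_(r < tdim p.+1) (bd K (simplex k) (simplex r) *
    bd K (simplex r) (simplex l)) *:
      ('X_[lcms (simplex k) - lcms (simplex l)] : S)).
  apply: eq_bigr => r _; rewrite !mxE -scalerAl -scalerAr scalerA.
  have [->|kr] := eqVneq (bd K (simplex k) (simplex r)) 0.
    by rewrite !mul0r !scale0r.
  have [->|rl] := eqVneq (bd K (simplex r) (simplex l)) 0.
    by rewrite !mulr0 !scale0r.
  congr (_ *: _); rewrite -mpolyXD; congr 'X_[_]; apply/mnmP => x.
  have /mnm_lepP/(_ x) h1 := bd_lcms a kr.
  have /mnm_lepP/(_ x) h2 := bd_lcms a rl.
  by rewrite !mnmE addnBA // subnK.
rewrite -scaler_suml (sum_simplex p.+1 (fun s => bd K (simplex k) s * bd K s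
  (simplex l))).
by rewrite [X in X *: _](@bound_bd K T p.+1) ?scale0r // size_simplex.
Qed.

(** In multidegree [m] only the generators dividing [m] occur, and the cone over any one of them
    contracts the complex; if there are none, no nonempty simplex occurs. *)
Lemma taylor_mx_exact p (v : 'rV[S]_(tdim p.+1)) :
  v *m taylor_mx p = 0 <-> exists w, v = w *m taylor_mx p.+1.
Proof.
split=> [v0|[w ->]]; last by rewrite -mulmxA taylor_mxM mulmx0.
pose h m s := if [pick b | (a b <= m)%MM] is Some u
              then cone u (slice v m) s else 0.
(* [N] exceeds the degree of every monomial in [v]. Adding a vertex can only enlarge the lcm, so
   cofactor degrees do not grow and the coned slices assemble into polynomials. *)
pose N := \sum_k msize (v 0 k).
pose w : 'rV[S]_(tdim p.+2) := \row_k
  \sum_(m : 'X_{1..n < N}) h (m + lcms (simplex k))%MM (simplex k) *: 'X_[m].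
have h_bound m s : size s = p.+2 -> h m s != 0 ->
    (lcms s <= m)%MM && (mdeg (m - lcms s) < N)%N.
  rewrite /h; case: pickP => [u um|]; last by rewrite eqxx.
  case: s => [|b t] //= [st]; have [->|] := eqVneq b u;
    last by rewrite mul0r eqxx.
  rewrite mul1r lem_mlcm um /slice; case: ifP => [tm|]; last by rewrite eqxx.
  case/simplex_onto: st tm => k <- km; rewrite extend_simplex => vk /=.
  apply: (@leq_ltn_trans (mdeg (m - lcms (simplex k)))).
    apply: lepm_mdeg; apply/mnm_lepP => x; rewrite !mnmE leq_sub2l //.
    exact: leq_maxr.
  apply: (@leq_trans (msize (v 0 k))).
    by apply: msize_mdeg_lt; rewrite mcoeff_msupp.
  by rewrite /N (bigD1 k) //= leq_addr.
have slice_w m s : size s = p.+2 -> slice w m s = h m s.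
  move=> ss; have [h0|/(h_bound _ _ ss)/andP[sm mN]] := eqVneq (h m s) 0.
    rewrite h0 /slice; case: ifP => // sm.
    case/simplex_onto: ss h0 sm => k <- h0 sm.
    by rewrite extend_simplex mxE (mcoeff_trunc (fun e => h (e + lcms (simplex
      k))%MM _)) submK // h0 if_same.
  rewrite /slice sm; case/simplex_onto: ss sm mN => k <- sm mN.
  by rewrite extend_simplex mxE (mcoeff_trunc (fun e => h (e + lcms (simplex
    k))%MM _)) mN submK.
exists w; apply: slice_inj => m s ss sm; rewrite slice_taylor //.
have -> : bound p.+2 (slice w m) s = bound p.+2 (h m) s.
  by apply: eq_bigr => x _; rewrite slice_w // size_tuple.
case: s ss sm => [|c t] // [st] /=; rewrite lem_mlcm => /andP[cm tm].
rewrite /h; case: pickP => [u um|/(_ c)]; last by rewrite cm.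
rewrite bound_cone /= st eqxx -slice_taylor // v0.
case/simplex_onto: st => l <-.
by rewrite [slice 0 _ _]/slice extend_simplex mxE mcoeff0 if_same mulr0 subr0.
Qed.

End TaylorMatrices.

(** * The Taylor complex as a graded free resolution of [I] *)

Section TaylorResolution.
Variables (n : nat) (K : fieldType) (T : finType) (a : T -> 'X_{1..n}).
Local Notation S := {mpoly K[n]}.
Local Notation lcms := (lcms a).
Variable I : S -> Prop.
Hypothesis I_generated : forall f : S,
  I f <-> exists c : T -> S, f = \sum_b c b * 'X_[a b].

(** Degree [i] uses tuples of length [i.+1]: the ideal is resolved, not its quotient, so the empty
    tuple is dropped. *)
Let taylor_shift i (k : 'I_(tdim T i.+1)) : int := (mdeg (lcms (simplex k)))%:Z.

Let taylor_aug : 'cV[S]_(tdim T 1) := \col_k 'X_[lcms (simplex k)].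

Lemma taylor_dif_homog i (k : 'I_(tdim T i.+2)) (l : 'I_(tdim T i.+1)) m :
  m \in msupp (taylor_mx K a i.+1 k l) ->
  taylor_shift k = (mdeg m)%:Z + taylor_shift l.
Proof.
rewrite mcoeff_msupp mxE mcoeffZ mcoeffX mulf_eq0 negb_or.
case/andP=> /(bd_lcms a) le.
have [<- _|_] := eqVneq (lcms (simplex k) - lcms (simplex l))%MM m; last first.
  by rewrite eqxx.
by rewrite /taylor_shift -PoszD -mdegD submK.
Qed.

Lemma taylor_aug_homog (k : 'I_(tdim T 1)) m :
  m \in msupp (taylor_aug k 0) -> taylor_shift k = (mdeg m)%:Z.
Proof. by rewrite mxE msuppX inE => /eqP ->. Qed.

Lemma sum_simplex1 (V : nmodType) (F : seq T -> V) :
  \sum_(k < tdim T 1) F (simplex k) = \sum_b F [:: b].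
Proof.
rewrite sum_simplex big_tuple_cons; apply: eq_bigr => b _.
by rewrite (big_pred1 [tuple]) // => x; rewrite [x]tuple0; apply/esym/eqxx.
Qed.

(** The augmentation is in effect the Taylor differential onto the empty tuple, whose lcm is 1. *)
Lemma taylor_aug_exact (v : 'rV[S]_(tdim T 1)) :
  v *m taylor_aug = 0 <-> exists w, v = w *m taylor_mx K a 1.
Proof.
rewrite -taylor_mx_exact.
have E l : (v *m taylor_mx K a 0) 0 l = (v *m taylor_aug) 0 0.
  rewrite !mxE; apply: eq_bigr => k _; rewrite !mxE; congr (_ * _).
  have /size0nil -> := size_simplex l.
  have := size_simplex k; case: (simplex k) => [|b []] //= _.
  by rewrite subr0 scale1r subm0.
split=> v0; apply/rowP => l; first by rewrite E v0 !mxE.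
have [l0 _] := simplex_onto (erefl (size (@nil T))).
by rewrite ord1 -(E l0) v0 !mxE.
Qed.

Lemma taylor_aug_onto f :
  I f <-> exists v : 'rV[S]_(tdim T 1), f = (v *m taylor_aug) 0 0.
Proof.
rewrite I_generated; split=> [[c ->]|[v ->]].
  pose g s := if s is b :: _ then c b else 0.
  exists (\row_k g (simplex k)); rewrite mxE.
  under eq_bigr do rewrite -[a _]mlcm0.
  rewrite -(sum_simplex1 (fun s => g s * 'X_[lcms s])).
  by apply: eq_bigr => k _; rewrite !mxE.
exists (fun b => extend v [:: b]); rewrite mxE.
transitivity (\sum_(k < tdim T 1) extend v (simplex k) * 'X_[lcms (simplex k)]).
  by apply: eq_bigr => k _; rewrite mxE extend_simplex.
rewrite (sum_simplex1 (fun s => extend v s * 'X_[lcms s])).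
by under eq_bigr do rewrite /= mlcm0.
Qed.

Definition taylor : graded_free_resolution I :=
  GradedFreeResolution taylor_dif_homog taylor_aug_homog
    (fun i => @taylor_mx_exact n K T a i.+1) taylor_aug_exact taylor_aug_onto.

Lemma dif_tensor_taylor i k l :
  dif_tensor taylor i k l = bd_tensor K a (simplex k) (simplex l).
Proof.
rewrite !mxE mcoeffZ mcoeffX /bd_tensor.
have [->|/(bd_lcms a) le] := eqVneq (bd K (simplex k) (simplex l)) 0.
  by rewrite mul0r if_same.
have -> : (lcms (simplex k) - lcms (simplex l) == 0)%MM =
          (lcms (simplex k) == lcms (simplex l)).
  by rewrite -(eqm_add2r (lcms (simplex l))) submK // add0m.
by case: ifP; rewrite ?mulr1 ?mulr0.
Qed.

Lemma mul_dif_tensor_taylor i (v : 'rV[K]_(tdim T i.+2)) l :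
  (v *m dif_tensor taylor i) 0 l = bound_tensor a i.+2 (extend v) (simplex l).
Proof.
rewrite mxE /bound_tensor.
rewrite -(sum_simplex i.+2 (fun s => extend v s * bd_tensor K a s (simplex l))).
by apply: eq_bigr => k _; rewrite dif_tensor_taylor extend_simplex.
Qed.

Lemma taylor_cyclesP i (v : 'rV[K]_(tdim T i.+1)) :
  reflect (forall t, size t = i -> (0 < i)%N ->
             bound_tensor a i.+1 (extend v) t = 0)
          (v <= tensor_cycles taylor i)%MS.
Proof.
apply: (iffP idP); case: i v => [|i] v h //=; last 1 first.
- apply/sub_kermxP/rowP => l.
  by rewrite mul_dif_tensor_taylor h ?size_simplex // mxE.
- move=> t /simplex_onto[l <-] _.
  by move/sub_kermxP: h => h; rewrite -mul_dif_tensor_taylor h mxE.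
exact: submx1.
Qed.

Lemma taylor_betti_eq0P i j : graded_betti taylor i j%:Z = 0%N <->
  forall f : seq T -> K,
    (forall t, size t = i -> (0 < i)%N -> bound_tensor a i.+1 f t = 0) ->
    (forall t, size t = i.+1 -> f t != 0 -> mdeg (lcms t) = j) ->
    exists w, forall t, size t = i.+1 -> f t = bound_tensor a i.+2 w t.
Proof.
rewrite betti_eq0P; split=> h.
  move=> f f_cycle f_deg; pose v : 'rV[K]_(tdim T i.+1) := \row_k f (simplex k).
  have vE t : size t = i.+1 -> extend v t = f t.
    by move=> /simplex_onto[k <-]; rewrite extend_simplex mxE.
  have /h : (v <= tensor_cycles taylor i)%MS.
    apply/taylor_cyclesP => t st i0; rewrite -(f_cycle t) //.
    by apply: eq_bound_tensor => s _; rewrite vE ?size_tuple.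
  case/(_ _)/submxP=> [|w wE].
    apply/rowP => k; rewrite mul_degree_part; case: eqP => // ne.
    rewrite mxE; apply/esym/eqP; apply/negP => /negP f0; apply: ne.
    by congr Posz; apply: f_deg f0; rewrite size_simplex.
  exists (extend w) => t st; rewrite -vE //.
  case/simplex_onto: st => k <-.
  by rewrite -mul_dif_tensor_taylor -wE extend_simplex.
move=> v /taylor_cyclesP v_cycle vj.
have [|w wE] := h _ v_cycle.
  move=> t /simplex_onto[k <-];
    rewrite extend_simplex -vj (@mul_degree_part _ _ _ taylor i).
  by case: ifP => [/eqP[]//|_]; rewrite eqxx.
apply/submxP; exists (\row_k w (simplex k)); apply/rowP => l.
rewrite mul_dif_tensor_taylor -extend_simplex wE ?size_simplex //.
apply: eq_bound_tensor => s _.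
by case: (simplex_onto (size_tuple s)) => k <-; rewrite extend_simplex mxE.
Qed.

Lemma taylor_gap d i j : (forall b, (mdeg (a b) <= d)%N) ->
  (forall k, (k < d)%N -> graded_betti taylor i (j + k)%N%:Z = 0%N) ->
  graded_betti taylor i.+1 (j + d)%N%:Z = 0%N.
Proof.
move=> a_le_d h; apply/taylor_betti_eq0P => f f_cycle.
apply: (gap a_le_d) => [k /h/taylor_betti_eq0P // | t st].
exact: f_cycle.
Qed.

End TaylorResolution.

(** * Reduction to finitely many generators, and the conclusion *)

(** Finiteness is read off from [F]: the finitely many entries of [aug F] generate [I], and each
    involves finitely many monomials of [G]. *)
Lemma finitely_many_generators (n : nat) (K : fieldType)
    (I : {mpoly K[n]} -> Prop) (G : 'X_{1..n} -> Prop)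
    (F : graded_free_resolution I) : generated_by G I ->
  exists A : seq 'X_{1..n}, (forall m, m \in A -> G m) /\
    forall f, I f <->
      exists c : seq_sub A -> {mpoly K[n]}, f = \sum_b c b * 'X_[val b].
Proof.
move=> gen.
have /fin_all_exists[r rE] : forall k : 'I_(rk F 0),
    exists s : seq ({mpoly K[n]} * 'X_{1..n}),
      (forall p, p \in s -> G p.2) /\
      aug F k 0 = \sum_(p <- s) p.1 * 'X_[p.2].
  move=> k; apply/gen/(aug_onto F); exists (delta_mx 0 k).
  by rewrite -rowE mxE.
pose A := flatten [seq [seq p.2 | p <- r k] | k <- enum 'I_(rk F 0)].
have AG m : m \in A -> G m.
  move=> /flatten_mapP[k _ /mapP[p pr ->]].
  exact: (rE k).1.
exists A; split=> // f; split=> [/(aug_onto F)[v ->]|[c ->]].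
  rewrite mxE; elim/big_ind: _ => [|f1 f2 [c1 ->] [c2 ->]|k _].
  - by exists (fun=> 0); rewrite big1 // => b _; rewrite mul0r.
  - exists (fun b => c1 b + c2 b); rewrite -big_split /=.
    by apply: eq_bigr => b _; rewrite mulrDl.
  rewrite (rE k).2 mulr_sumr big_seq.
  elim/big_ind: _ => [|f1 f2 [c1 ->] [c2 ->]|p pr].
  - by exists (fun=> 0); rewrite big1 // => b _; rewrite mul0r.
  - exists (fun b => c1 b + c2 b); rewrite -big_split /=.
    by apply: eq_bigr => b _; rewrite mulrDl.
  have pA : p.2 \in A.
    by apply/flatten_mapP; exists k; rewrite ?mem_enum ?map_f.
  exists (fun b => if b == SeqSub pA then v 0 k * p.1 else 0).
  rewrite (bigD1 (SeqSub pA)) //= eqxx big1 ?addr0 ?mulrA //.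
  by move=> b /negPf ->; rewrite mul0r.
apply/gen; exists [seq (c b, val b) | b <- enum {: seq_sub A}].
rewrite big_map big_enum; split=> // _ /mapP[b _ ->] /=.
exact/AG/valP.
Qed.

Theorem theorem2p1 (K : fieldType) (n : nat)
    (I : {mpoly K[n]} -> Prop) (HI : monomial_ideal I)
    (I_neq0 : exists f : {mpoly K[n]}, I f /\ f <> 0)
    (G : 'X_{1..n} -> Prop) (HG : minimal_generators I G)
    (d : nat) (d_attained : exists u : 'X_{1..n}, G u /\ mdeg u = d)
    (d_max : forall u : 'X_{1..n}, G u -> (mdeg u <= d)%N)
    (F : graded_free_resolution I)
    (i j : nat) (le_id_j : (i + d <= j)%N)
    (betti_eq0 : forall k : nat, (k < d)%N ->
       graded_betti F i (j + k)%N%:Z = 0%N) :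
  graded_betti F i.+1 (j + d)%N%:Z = 0%N.
Proof.
have [A [AG I_gen]] := finitely_many_generators F HG.1.
apply: (@betti_eq0_independent _ _ _ _ (taylor I_gen)).
apply: taylor_gap => [b|k kd]; first exact/d_max/AG/valP.
exact: betti_eq0_independent (betti_eq0 k kd).
Qed.
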